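(* Let $I$ be an uncountable set. Then there is no function $f\in\mathcal{A}(D^I)$ such that for every point $\theta\in\mathbb{T}^I$ and every direction $v\in\mathbb{R}^I$ with $\|v\|_\infty=1$ both functions $u=\mathrm{Re} f|_{\mathbb{T}^I}$ and $\tilde u=\mathrm{Im} f|_{\mathbb{T}^I}$ are not differentiable at $\theta$ in the direction $v$.
   Context: $D$ is the open unit disc in $\mathbb{C}$, $\overline{D}$ its closure, $\mathbb{T}$ the unit circle. $\overline{D}^I=\{(z_i)_{i\in I}: |z_i|\le 1 \text{ for every } i\in I\}$ carries the product (cartesian) topology. The polydisc algebra $\mathcal{A}(D^I)$ is the set of functions $f:\overline{D}^I\to\mathbb{C}$ that are continuous on $\overline{D}^I$ and separately holomorphic in $D^I$ (holomorphic in each coordinate when the others are fixed). A function $F$ on $\mathbb{T}^I$ is identified with the function $(\theta_i)_{i\in I}\mapsto F((e^{i\theta_i})_{i\in I})$ on $\mathbb{R}^I$ (here the $i$ in the exponent is the imaginary unit), which is $2\pi$-periodic in every coordinate, and points of $\mathbb{T}^I$ are correspondingly represented by $\theta\in\mathbb{R}^I$. For $v=(v_i)_{i\in I}\in\mathbb{R}^I$, $\|v\|_\infty=\sup_{i\in I}|v_i|$. A real-valued function $u$ on $\mathbb{T}^I$ is differentiable at $\theta$ in the direction $v$ if the limit $\lim_{t\to0}\frac{u(\theta+tv)-u(\theta)}{t}$ ($t$ real) exists in $\mathbb{R}$. *)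

(* Defs.v *)
From HB Require Import structures.
From mathcomp Require Import all_boot all_order all_algebra.
From mathcomp Require Import all_classical all_reals all_analysis.
From mathcomp Require Export complex.

Set Implicit Arguments.
Unset Strict Implicit.
Unset Printing Implicit Defensive.

Import Order.TTheory GRing.Theory Num.Theory.
Import numFieldNormedType.Exports.

Local Open Scope classical_set_scope.
Local Open Scope ring_scope.
Local Open Scope complex_scope.

(* The topology of the complex field is the one defined by its modulus; the
   analysis library attaches it to the regular module [R[i]^o]. *)
Notation Cplx R := (R[i]^o) (only parsing).

Section PolydiscAlgebra.
Context {R : realType} {I : Type}.

Definition closed_disc : set (Cplx R) := [set w | `|w| <= 1].

Definition open_disc : set (Cplx R) := [set w | `|w| < 1].

Definition closed_polydisc : set {ptws I -> Cplx R} :=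
  [set z | forall i, closed_disc (z i)].

Definition open_polydisc : set {ptws I -> Cplx R} :=
  [set z | forall i, open_disc (z i)].

(* [derivable] is taken over the scalar field [R[i]], so that the difference
   quotient converges along complex increments. *)
Definition holomorphic_on (U : set (Cplx R)) (g : Cplx R -> Cplx R) : Prop :=
  forall w, U w -> derivable g w 1.

Definition set_coord (z : {ptws I -> Cplx R}) (i : I) (w : Cplx R) :
    {ptws I -> Cplx R} :=
  fun j => if `[< j = i >] then w else z j.

Definition separately_holomorphic (f : {ptws I -> Cplx R} -> Cplx R) : Prop :=
  forall z, open_polydisc z -> forall i : I,
    holomorphic_on open_disc (fun w => f (set_coord z i w)).

(* Elements of the algebra are represented by total functions, of which only
   the values on the closed polydisc matter; [{ptws _ -> _}] carries the
   product topology and [within] takes the induced one on the polydisc. *)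
Definition polydisc_algebra : set ({ptws I -> Cplx R} -> Cplx R) :=
  [set f | {within closed_polydisc, continuous f} /\ separately_holomorphic f].

Definition torus_point (theta : I -> R) : {ptws I -> Cplx R} :=
  fun i => cos (theta i) +i* sin (theta i).

Definition boundary_re (f : {ptws I -> Cplx R} -> Cplx R) (theta : I -> R) : R :=
  complex.Re (f (torus_point theta)).

Definition boundary_im (f : {ptws I -> Cplx R} -> Cplx R) (theta : I -> R) : R :=
  complex.Im (f (torus_point theta)).

(* Extended-real valued, so that unbounded directions have norm [+oo]. *)
Definition sup_norm (v : I -> R) : \bar R :=
  ereal_sup [set (`|v i|)%:E | i in [set: I]].

Definition differentiable_along (u : (I -> R) -> R) (theta v : I -> R) : Prop :=
  exists l : R,
    (u (fun i => theta i + t * v i) - u theta) / t @[t --> 0^'] --> l.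

End PolydiscAlgebra.

(* Main.v *)
Require Import Defs.
From mathcomp Require Import all_boot all_order all_algebra.
From mathcomp Require Import all_classical all_reals all_analysis.

Local Open Scope classical_set_scope.
Local Open Scope ring_scope.

Import Order.TTheory GRing.Theory Num.Theory.
Import numFieldNormedType.Exports.

(** A basic neighbourhood in a product constrains finitely many coordinates, so
    intersecting a sequence of neighbourhoods constrains only countably many.
    Hence a complex function continuous at a point [p] takes the value [f p] at
    every point of its domain that agrees with [p] on a suitable countable set
    [J] of coordinates ([continuous_countable_dependence]).  When the index set
    is uncountable, some coordinate [i] lies outside the set [J] attached to the
    torus point of angle [0].  Along the unit coordinate direction of [i] only
    the [i]-th coordinate moves, so [f] is constant there, and its real part has
    derivative [0] at the origin in a direction of sup norm [1]. *)

(** The sets of points agreeing with [p] on a finite set of coordinates generate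
    a filter.  Each coordinate is eventually constant along it, equal to that of
    [p], so it converges to [p] in the product topology, which is the claim. *)
Lemma ptws_nbhs_finite_dependence (I : Type) (T : topologicalType)
    (p : {ptws I -> T}) (U : set {ptws I -> T}) :
  nbhs p U ->
  exists D : set I, finite_set D /\
    forall z : {ptws I -> T}, (forall i, D i -> z i = p i) -> U z.
Proof.
pose F : set_system {ptws I -> T} := [set V | exists D : set I, finite_set D /\
  forall z : {ptws I -> T}, (forall i, D i -> z i = p i) -> V z].
have FF : Filter F.
  split.
  - by exists set0; split.
  - move=> V W [D [Dfin DV]] [E [Efin EW]].
    exists (D `|` E); split; first by rewrite finite_setU.
    by move=> z zDE; split; [apply: DV|apply: EW] => i iDE; apply: zDE;
      [left|right].
  - by move=> V W VW [D [Dfin DV]]; exists D; split=> // z /DV /VW.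
suff: F --> p by move=> /[apply].
apply/cvg_sup => i V [W [[B openB BW] Wp] WV].
exists [set i]; split; first exact: finite_set1.
by move=> z zp; apply: WV; move: Wp; rewrite -BW /= zp.
Qed.

(** The order on [R[i]] is partial, so the archimedean argument is carried out on
    the real number whose embedding is the modulus. *)
Lemma complex_eq_norm_lt_invS (R : realType) (a b : Cplx R) :
  (forall n : nat, `|a - b| < (n.+1%:R^-1)%:C%C) -> a = b.
Proof.
move=> ab; apply/eqP; rewrite -subr_eq0 -normr_le0.
move: ab; rewrite normc_def.
set r : R := Num.sqrt _ => ab.
rewrite (lecR r 0) leNgt; apply/negP => r0.
have : (0 : R) < r by [].
move=> /ltr_add_invr [n]; rewrite add0r => /ltW.
by rewrite leNgt -ltcR ab.
Qed.

(** [J] is the union over [n] of finite sets of coordinates that determine the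
    value of [f] up to [1 / (n + 1)] near [p]. *)
Lemma continuous_countable_dependence (R : realType) (I : Type)
    (A : set {ptws I -> Cplx R}) (f : {ptws I -> Cplx R} -> Cplx R)
    (p : {ptws I -> Cplx R}) :
  {within A, continuous f} -> A p ->
  exists J : set I, countable J /\
    forall z : {ptws I -> Cplx R}, A z -> (forall i, J i -> z i = p i) ->
      f z = f p.
Proof.
move=> /subspace_continuousP fA Ap.
have near_p (n : nat) : exists D : set I, finite_set D /\
    forall z : {ptws I -> Cplx R}, (forall i, D i -> z i = p i) ->
      A z -> `|f p - f z| < (n.+1%:R^-1)%:C%C.
  apply: ptws_nbhs_finite_dependence.
  have e0 : 0 < (n.+1%:R^-1 : R)%:C%C by rewrite (ltcR 0) invr_gt0 ltr0n.
  by have /cvgrPdist_lt/(_ _ e0) := fA _ Ap.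
have [D DP] := choice near_p.
exists (\bigcup_n D n); split.
  apply: bigcup_countable => // n _.
  exact/finite_set_countable/(proj1 (DP n)).
move=> z Az zp; apply/esym/complex_eq_norm_lt_invS => n.
by apply: (proj2 (DP n)) => // i Di; apply: zp; exists n.
Qed.

Lemma torus_point_closed_polydisc (R : realType) (I : Type) (theta : I -> R) :
  closed_polydisc (torus_point theta).
Proof.
by move=> i; rewrite /closed_disc /= normc_def /= cos2Dsin2 sqrtr1.
Qed.

Definition coord_dir (R : realType) (I : Type) (i : I) : I -> R :=
  fun j => if `[< j = i >] then 1 else 0.

Lemma sup_norm_coord_dir (R : realType) (I : Type) (i : I) :
  sup_norm (coord_dir R I i) = 1%E.
Proof.
apply/eqP; rewrite eq_le; apply/andP; split.
- apply: ge_ereal_sup => _ [j _ <-].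
  by rewrite lee_fin /coord_dir; case: ifP; rewrite ?normr1 ?normr0.
- apply: ereal_sup_ubound; exists i => //.
  by rewrite /coord_dir asboolT // normr1.
Qed.

Lemma differentiable_along_cst (R : realType) (I : Type) (u : (I -> R) -> R)
    (theta v : I -> R) :
  (forall t : R, u (fun i => theta i + t * v i) = u theta) ->
  differentiable_along u theta v.
Proof.
move=> u_cst; exists 0.
rewrite (_ : (fun t => _) = fun=> 0); first exact: cvg_cst.
by apply/funext => t; rewrite u_cst subrr mul0r.
Qed.

Theorem mainTheorem3 (R : realType) (I : Type)
    (uncountable_I : ~ countable [set: I]) :
  ~ exists f : {ptws I -> Cplx R} -> Cplx R,
      polydisc_algebra f /\
      forall theta v : I -> R, sup_norm v = 1%E ->
        ~ differentiable_along (boundary_re f) theta v /\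
        ~ differentiable_along (boundary_im f) theta v.
Proof.
move=> [f [[f_cont _] f_nondiff]].
pose theta : I -> R := fun=> 0.
have [J [J_countable Jf]] := continuous_countable_dependence R I _ f _ f_cont
  (torus_point_closed_polydisc R I theta).
have [i iJ] : exists i, ~ J i.
  apply/existsNP => JT; apply: uncountable_I.
  by rewrite (_ : setT = J) //; apply/seteqP; split.
have [re_nondiff _] := f_nondiff theta _ (sup_norm_coord_dir R I i).
apply: re_nondiff; apply: differentiable_along_cst => t.
congr complex.Re; apply: Jf; first exact: torus_point_closed_polydisc.
move=> j Jj; rewrite /torus_point /coord_dir asboolF ?mulr0 ?addr0 //.
by move=> ji; apply: iJ; rewrite -ji.
Qed.
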